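(* Assume that $F$ maps a compact set $\mathcal{X}$ to itself. Let $\theta_1,\theta_2,\dots$ be the sequence of iterates generated by the dynamical system $\theta_{t+1}=F(\theta_t)$, and let $\mu_n=\frac1n\sum_{t=1}^n\delta_{\theta_t}$ be the empirical distribution. Then the empirical distribution has a subsequence converging weakly to an ergodic distribution. In other words, there exist an invariant distribution $\mu$ and a subsequence of positive integers $\{n_k\}$ such that $\mu_{n_k}$ converges weakly to $\mu$.
   Context: $\mathcal{X}$ is a compact metric space, and the update map $F:\mathcal{X}\to\mathcal{X}$ may be deterministic or stochastic (for example, a stochastic gradient update). $\delta_\theta$ denotes the Dirac measure at $\theta$. A measure $\mu$ on $\mathcal{X}$ is invariant for $F$ if for every measurable set $A$, $\mu(A)=\mu(F^{-1}(A))=\int\mathbf{1}\{F(\theta)\in A\}\,d\mu(\theta)$, where $F^{-1}(A)=\{\theta : F(\theta)\in A\}$; when $F$ is stochastic this is read as $\mu(A)=\int\mathbb{P}\{F(\theta)\in A\}\,d\mu(\theta)$. The word ''ergodic'' in the first form of the conclusion is not separately defined by the authors; the sentence beginning ''In other words'' is their own explanation of it.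
   Formalization: F is additionally assumed continuous (if stochastic: the law of F(θ) depends weakly continuously on θ, i.e. Feller); without this the claim is false, e.g. F(0)=1, F(x)=x/2 for x>0 on [0,1] has no invariant distribution. *)

(* Defs.v *)
From HB Require Import structures.
From mathcomp Require Import all_boot all_order all_algebra.
From mathcomp Require Import all_classical all_reals all_analysis.

Set Implicit Arguments.
Unset Strict Implicit.
Unset Printing Implicit Defensive.
Import Order.TTheory GRing.Theory Num.Theory.
Import numFieldNormedType.Exports.

Local Open Scope classical_set_scope.
Local Open Scope ring_scope.

(* Measurable types are pointed in the library, so a metric space carrying a
   Borel sigma-algebra has to be pointed, i.e., nonempty. *)
#[short(type="pmetricType")]
HB.structure Definition PointedMetric (K : numDomainType) :=
  { M of Metric K M & Pointed M }.

Definition Borel (X : ptopologicalType) := g_sigma_algebraType (@open X).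

Section measures.
Context {R : realType} {X : ptopologicalType}.
Implicit Types mu : {measure set (Borel X) -> \bar R}.

Definition weakly_cvg (mu_ : nat -> {measure set (Borel X) -> \bar R}) mu :=
  forall f : X -> R, continuous f -> [bounded f x | x in [set: X]] ->
    \int[mu_ n]_x f x @[n --> \oo] --> \int[mu]_x f x.

(* Iterates are numbered from 0: [theta t] is the (t+1)-st iterate, so that
   [empirical theta n] averages the Dirac measures at the first n iterates. *)
Definition empirical (theta : nat -> X) (n : nat) :
    {measure set (Borel X) -> \bar R} :=
  mscale (n%:R^-1)%:nng (msum (fun t => \d_(theta t : Borel X)) n).

Definition invariant_map (F : X -> X) mu :=
  forall A : set (Borel X), measurable A -> mu A = mu (F @^-1` A).

End measures.

(* A stochastic update map is a function F of a noise variable z, of law nu,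
   and of the current point x. *)
Section stochastic_map.
Context {R : realType} {X : ptopologicalType}.
Context {dZ : measure_display} {Z : measurableType dZ}.
Implicit Types (nu : probability Z R) (F : Z * Borel X -> Borel X).

Definition invariant_smap nu F (mu : {measure set (Borel X) -> \bar R}) :=
  forall A : set (Borel X), measurable A ->
    mu A = (\int[mu]_x nu [set z | A (F (z, x))])%E.

(* Continuity of x |-> Law(F(x)) for weak convergence (the Feller property);
   when F does not depend on the noise this is the continuity of F. *)
Definition weakly_continuous nu F :=
  forall f : X -> R, continuous f -> [bounded f x | x in [set: X]] ->
    continuous (fun x : X => \int[nu]_z f (F (z, x))).

(* xi t is the noise of the t-th update: it has law nu and is independent of
   the trajectory theta 0, ..., theta t (take A i = setT to get the law, and
   use that the events on the left generate the history). This holds as soon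
   as theta 0, xi 0, xi 1, ... are mutually independent and each xi t has law
   nu. *)
Definition stochastic_iterates {dO : measure_display} {Omega : measurableType dO}
    (P : probability Omega R) nu F
    (xi : nat -> {mfun Omega >-> Z}) (theta : nat -> {mfun Omega >-> Borel X}) :=
  (forall t w, theta t.+1 w = F (xi t w, theta t w)) /\
  (forall (t : nat) (A : nat -> set (Borel X)) (B : set Z),
    (forall i, measurable (A i)) -> measurable B ->
    let history := [set w | forall i, (i <= t)%N -> A i (theta i w)] in
    P (history `&` xi t @^-1` B) = (P history * nu B)%E).

End stochastic_map.

(* Main.v *)
(* By weak compactness, a subsequence of the empirical distributions converges
   weakly to some mu. The martingale differences f(theta_{t+1}) - Pf(theta_t),
   with Pf(x) = E f(F(x)), have averages tending to 0 almost surely along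
   n = 2^k, for all f in a countable family that determines measures. Hence mu
   and its image under the Markov kernel of F, whose continuity makes Pf
   continuous, integrate each such f to the same value, so they are equal.

   Weak compactness is obtained on the Cantor space, where the limits of the
   masses of the clopen sets along an ultrafilter extend to a measure, and is
   transported to X by a continuous surjection from the Cantor space. *)
Require Import Defs.
From HB Require Import structures.
From mathcomp Require Import all_boot all_order all_algebra.
From mathcomp Require Import all_classical all_reals all_analysis.
From mathcomp Require Import finmap measurable_realfun ring lra.

Set Implicit Arguments.
Unset Strict Implicit.
Unset Printing Implicit Defensive.
Import Order.TTheory GRing.Theory Num.Theory.
Import numFieldNormedType.Exports.

Local Open Scope classical_set_scope.
Local Open Scope ring_scope.

(** * A countable family of continuous functions separating measures *)

Section borel.
Context {R : realType} {X : ptopologicalType}.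

Lemma borel_open_measurable (U : set X) :
  open U -> measurable (U : set (Borel X)).
Proof. exact: sub_sigma_algebra. Qed.

Lemma borel_continuous_measurable (f : X -> R) :
  continuous f -> measurable_fun [set: Borel X] (f : Borel X -> R).
Proof.
move=> /continuousP cf; apply: (measurability _ (RGenOpens.measurableE R)).
move=> _ [_ [a [b ->] <-]]; rewrite setTI.
by apply: borel_open_measurable; apply: cf; exact: interval_open.
Qed.

Lemma borel_continuous_emeasurable (f : X -> R) :
  continuous f -> measurable_fun [set: Borel X] (EFin \o f).
Proof.
move=> /borel_continuous_measurable mf.
exact: (iffRL (@measurable_EFinP _ (Borel X) _ _ _)).
Qed.

Lemma borel_map_measurable d (T : measurableType d) (g : T -> Borel X) :
  (forall U : set X, open U -> measurable (g @^-1` U)) ->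
  measurable_fun [set: T] g.
Proof.
move=> gU; apply: (@measurability _ _ T (Borel X) setT g (@open X) erefl).
by move=> _ [U oU <-]; rewrite setTI; exact: gU.
Qed.

End borel.

Section bounded.
Context {R : realType} {d} {T : measurableType d}.

Lemma bounded_setT_ex (S : Type) (f : S -> R) :
  [bounded f x | x in [set: S]] -> exists M, forall x, `|f x| <= M.
Proof.
move=> [M [_ Mf]]; exists (`|M| + 1) => x.
by apply: Mf => //; rewrite ltr_pwDr// ler_norm.
Qed.

Lemma bounded_setT_intro (S : Type) (f : S -> R) M :
  (forall x, `|f x| <= M) -> [bounded f x | x in [set: S]].
Proof.
move=> fM; exists M; split; first exact: num_real.
by move=> x Mx s _; exact: le_trans (fM s) (ltW Mx).
Qed.

Lemma bounded_01 (S : Type) (f : S -> R) :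
  (forall x, 0 <= f x <= 1) -> [bounded f x | x in [set: S]].
Proof.
move=> f01; apply: (@bounded_setT_intro _ _ 1) => x.
by have /andP[f0 f1] := f01 x; rewrite ger0_norm.
Qed.

Lemma finite_bounded_integrable (P : {finite_measure set T -> \bar R})
    (f : T -> R) M :
  measurable_fun [set: T] f -> (forall x, `|f x| <= M) ->
  P.-integrable [set: T] (EFin \o f).
Proof.
move=> mf fM; apply: measurable_bounded_integrable => //.
- by rewrite ltey_eq fin_num_measure.
- exact: bounded_setT_intro fM.
Qed.

Lemma probability_Rintegral_cst (P : probability T R) (r : R) :
  \int[P]_x r = r.
Proof. by rewrite Rintegral_cst//= probability_setT mulr1. Qed.

End bounded.

Section separating_family.
Context {R : realType} {X : pmetricType R}.

Lemma mdist_continuous (p : X) : continuous (mdist p : X -> R).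
Proof.
move=> x; apply/cvgrPdist_lt => e e0; near=> y.
have xy : mdist x y < e.
  by near: y; apply/nbhs_ballP; exists e => //= y; rewrite ballEmdist.
rewrite (le_lt_trans _ xy)// ler_norml lerBlDr lerBrDr; apply/andP; split.
  by rewrite addrC lerBlDr metric_triangle.
by rewrite (@metric_sym _ _ x y) addrC metric_triangle.
Unshelve. all: by end_near. Qed.

(** The bumps are [max(0, 1/(n+1) - d(p, y))], with [p] a chosen point of a set of a countable base.
    Such a bump is positive exactly on the ball of radius [1/(n+1)] about [p], and these countably
    many balls form a base. *)
Lemma bump_family : compact [set: X] -> exists b : nat -> X -> R,
  [/\ forall i, continuous (b i), forall i x, 0 <= b i x &
      forall (U : set X) x, open U -> U x ->
        exists i, 0 < b i x /\ [set y | 0 < b i y] `<=` U].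
Proof.
move=> /compact_second_countable[B /pfcard_geP cB [oB Bbase]].
have [e Be] : exists e : nat -> set X, forall V, B V -> exists i, e i = V.
  case: cB => [->|[e]]; first by exists (fun=> set0).
  by exists e => V BV; have [i _ <-] := 'surj_e BV; exists i.
pose p i : X := get (e i).
pose b0 i n (y : X) : R := Num.max 0 (n.+1%:R^-1 - mdist (p i) y).
(* One index codes a pair of centre and radius; numbers that code nothing give the zero function,
   whose positivity set is empty. *)
pose b k := if choice.unpickle k is Some (i, n) then b0 i n else fun=> 0.
exists b; split.
- move=> k; rewrite /b; case: choice.unpickle => [[i n]|];
    last exact: cst_continuous.
  move=> y; apply: (@continuous_max _ _ (fun=> 0) (fun y => _ - mdist (p i) y)).
    exact: cst_continuous.
  by apply: cvgB; [exact: cvg_cst|exact: mdist_continuous].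
- move=> k y; rewrite /b; case: choice.unpickle => [[i n]|//].
  by rewrite /b0 le_max lexx.
- move=> U x oU Ux.
  have /nbhs_ballP[_/posnumP[ep] epU] : nbhs x U by exact: open_nbhs_nbhs.
  (* The radius is below [ep / 2], so a ball of this radius that contains [x] stays within distance
     [ep] of [x]. *)
  have [//|n] := @ltr_add_invr R 0%R (ep%:num / 2) _; rewrite add0r => nep.
  have n0 : 0 < n.+1%:R^-1 :> R by rewrite invr_gt0.
  have [V [BV Vx Vn]] := Bbase x _ (nbhsx_ballx x _ n0).
  have [i eiV] := Be V BV.
  have pV : V (p i).
    by rewrite /p eiV; apply: getPex; exists x.
  have := Vn _ pV; rewrite ballEmdist/= => pn.
  exists (choice.pickle (i, n)); rewrite /b choice.pickleK /b0; split.
    by rewrite lt_max subr_gt0 metric_sym pn orbT.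
  move=> y /=; rewrite lt_max ltxx/= subr_gt0 => pyn.
  apply: epU; rewrite ballEmdist/=.
  by rewrite (le_lt_trans (metric_triangle x (p i) y))// [ltRHS]splitr ltrD//
    (lt_trans _ nep).
Qed.

(** The functions [min(1, m * sum of finitely many bumps)] form a countable family, and suitable
    ones tend pointwise to the indicator of any given open set. Equal integrals thus give equal
    masses of open sets, a pi-system that generates the Borel sets. *)
Lemma separating_family : compact [set: X] -> exists h : nat -> X -> R,
  [/\ forall n, continuous (h n), forall n x, 0 <= h n x <= 1 &
      forall mu1 mu2 : probability (Borel X) R,
        (forall n, \int[mu1]_x h n x = \int[mu2]_x h n x) ->
        forall A, measurable A -> mu1 A = mu2 A].
Proof.
move=> /bump_family[b [cb b0 bU]].
pose g (l : seq nat) m (x : X) : R :=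
  Num.min 1 (m%:R * \sum_(i <- l) b i x).
pose h k := if choice.unpickle k is Some (l, m) then g l m else fun=> 0.
have cg l m : continuous (g l m).
  move=> x; apply: (@continuous_min _ _ (fun=> 1)
    (fun x => m%:R * \sum_(i <- l) b i x)); first exact: cst_continuous.
  apply: cvgM; first exact: cvg_cst.
  have cs : continuous (fun x => \sum_(i <- l) b i x).
    apply: (@continuous_big R _ +%R 0 xpredT (@add_continuous R)).
    by move=> i _; exact: cb.
  exact: cs.
have g01 l m x : 0 <= g l m x <= 1.
  rewrite /g le_min ler01/= ge_min lexx/= andbT mulr_ge0// sumr_ge0// .
exists h; split.
- move=> k; rewrite /h; case: choice.unpickle => [[l m]|]; first exact: cg.
  exact: cst_continuous.
- move=> k x; rewrite /h; case: choice.unpickle => [[l m]|]; first exact: g01.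
  by rewrite lexx ler01.
- move=> mu1 mu2 mu12.
  have ig (mu : probability (Borel X) R) l m :
      mu.-integrable [set: Borel X] (EFin \o g l m).
    apply: (@finite_bounded_integrable _ _ _ mu _ 1).
      exact: borel_continuous_measurable (cg _ _).
    by move=> x; have /andP[? ?] := g01 l m x; rewrite ger0_norm.
  have {mu12} mu12 l m :
      (\int[mu1]_x (g l m x)%:E = \int[mu2]_x (g l m x)%:E)%E.
    have := congr1 EFin (mu12 (choice.pickle (l, m))).
    rewrite /Rintegral /h choice.pickleK.
    by rewrite !fineK//; apply: integrable_fin_num => //; exact: ig.
  move=> A; apply: (@g_sigma_algebra_measure_unique _ R (Borel X) (@open X) _
    (fun=> setT) _ _ mu1 mu2).
  + move=> U oU; exact: borel_open_measurable.
  + by move=> _; exact: openT.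
  + by rewrite bigcup_const//; exists 0%N.
  + exact: openI.
  + move=> U oU.
    (* Among the first [m] bumps, those that are positive only inside [U]. *)
    pose l m := [seq i <- iota 0 m | `[< [set y | 0 < b i y] `<=` U >]].
    have cvgU (mu : probability (Borel X) R) :
        (\int[mu]_x (g (l m) m x)%:E @[m --> \oo] --> mu U)%E.
      rewrite -(setIT U) -(integral_indic mu (@measurableT _ (Borel X)))//;
        last exact: borel_open_measurable.
      apply: (@dominated_cvg _ _ _ mu setT measurableT
        (fun m => EFin \o g (l m) m) (EFin \o \1_U) (fun=> 1%E)) => //.
      * by move=> m; exact: borel_continuous_emeasurable (cg _ _).
      * move=> x _; apply: cvg_EFin; first exact: nearW.
        rewrite indicE.
        have [/set_mem xU|/negP xU] := boolP (x \in U); last first.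
          (* Outside [U] all selected bumps vanish. *)
          apply: cvg_near_cst; apply: nearW => m; rewrite /g/= big_seq big1.
            by rewrite mulr0 min_r.
          move=> i; rewrite mem_filter => /andP[/asboolP iU _].
          apply/eqP; rewrite eq_le b0 andbT leNgt; apply/negP => /iU Ux.
          exact: (xU (mem_set Ux)).
        (* Inside [U] some bump [i] is positive at [x]. Once [m > i] and [m * b i x >= 1], the
           minimum is attained by 1. *)
        have [i [bix biU]] := bU U x oU xU.
        apply: cvg_near_cst; near=> m; rewrite /g/=; apply/min_idPl.
        have im : (i < m)%N by near: m; exists i.+1.
        have il : i \in l m.
          by rewrite mem_filter mem_iota add0n im !andbT; exact/asboolP.
        rewrite (bigD1_seq i)//=; last by rewrite filter_uniq ?iota_uniq.
        rewrite (@le_trans _ _ (m%:R * b i x))//; last first.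
          by rewrite ler_wpM2l// lerDl sumr_ge0.
        rewrite -ler_pdivrMr// div1r; near: m; exact: nbhs_infty_ger.
      * exact: finite_measure_integrable_cst.
      * move=> m x _ /=; have /andP[? ?] := g01 (l m) m x.
        by rewrite lee_fin ger0_norm.
    have := cvgU mu1; under eq_fun do rewrite mu12.
    by move=> c1; exact: (cvg_unique (@ereal_hausdorff R) c1 (cvgU mu2)).
  + by move=> _; rewrite ltey_eq fin_num_measure.
Unshelve. all: by end_near. Qed.

End separating_family.

(** * Weak compactness on the Cantor space *)

(** Compactness of [[0, 1]] gives a cluster point of the image filter, and a cluster point of an
    ultrafilter is a limit. *)
Lemma ultra_cvg01 (R : realType) (U : set_system nat) (u : nat -> R) :
  UltraFilter U -> (forall n, 0 <= u n <= 1) ->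
  exists2 l : R, 0 <= l & u @ U --> l.
Proof.
move=> UU u01.
have UI : U (u @^-1` `[0, 1]%classic).
  by apply: filterE => n; rewrite /= in_itv/= u01.
have [l [/=]] := @segment_compact R 0 1 (u @ U) _ UI.
rewrite in_itv => /andP[l0 _] lU; exists l => // V /= lV.
have [//|UV] := in_ultra_setVsetC (u @^-1` V) UU.
by have [y []] := lU (~` V) V UV lV.
Qed.

(** An alias of [T], so that the algebra of clopen sets can be attached to it as its measurable
    structure. *)
Definition clopen_algebra (T : ptopologicalType) : Type := T.

HB.instance Definition _ (T : ptopologicalType) :=
  Pointed.on (clopen_algebra T).
HB.instance Definition _ (T : ptopologicalType) :=
  @isAlgebraOfSets.Build default_measure_display (clopen_algebra T)
    (@clopen T) clopen0 clopenU (fun A => @clopenC T A A).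

(** * Extension of a finitely additive mass on clopen sets *)

Section clopen_content.
Context {R : realType} {T : ptopologicalType}.
Hypothesis compactT : compact [set: T].
Variable m : set T -> R.
Hypothesis m_ge0 : forall A, 0 <= m A.
Hypothesis mT : m setT = 1.
Hypothesis mU : forall A B, clopen A -> clopen B ->
  A `&` B = set0 -> m (A `|` B) = m A + m B.

Let mc (A : set (clopen_algebra T)) : \bar R := (m A)%:E.

Let m0 : m set0 = 0.
Proof.
by apply: (@addrI _ (m set0)); rewrite -mU ?setI0 ?setU0 ?addr0//;
  exact: clopen0.
Qed.

Let mc_bigsetU (F : (set T)^nat) n : (forall i, clopen (F i)) ->
  trivIset setT F ->
  m (\big[setU/set0]_(i < n) F i) = \sum_(i < n) m (F i).
Proof.
move=> cF tF; elim: n => [|n ih]; first by rewrite !big_ord0 m0.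
rewrite !big_ord_recr/= mU ?ih//.
  by apply: big_ind => //; [exact: clopen0|exact: clopenU].
by apply: (@trivIset_bigsetUI _ predT F) => //; exact: sub_trivIset tF.
Qed.

(* By compactness a clopen set is never a disjoint union of infinitely many
   nonempty clopen sets, so that finite additivity is enough. *)
Let mc_sigma_additive : semi_sigma_additive mc.
Proof.
move=> F cF tF [_ cUF].
have /(subclosed_compact cUF compactT) : \bigcup_n F n `<=` setT by [].
rewrite compact_cover => /(_ nat setT F)[||D _ DF].
  by move=> i _; have [] := cF i.
  by move=> x [i _ Fix]; exists i.
(* Beyond the largest index of a finite subcover, the partial unions already equal the whole union,
   so the partial sums are constant. *)
pose N := (\max_(i <- D) i).+1.
have DN i : i \in D -> (i < N)%N by move=> iD; rewrite ltnS leq_bigmax_seq.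
have UFN n : (N <= n)%N -> \big[setU/set0]_(i < n) F i = \bigcup_i F i.
  move=> Nn; apply/seteqP; split=> x.
    by rewrite -bigcup_mkord => -[i _ Fix]; exists i.
  move=> /DF[i /= iD Fix]; rewrite -bigcup_mkord; exists i => //=.
  exact: leq_trans (DN _ iD) Nn.
apply: cvg_near_cst; exists N => // n Nn.
by rewrite big_mkord /mc -(UFN _ Nn) mc_bigsetU// -sumEFin.
Qed.

HB.instance Definition _ := isMeasure.Build _ (clopen_algebra T) R mc
  (congr1 EFin m0) (fun A => m_ge0 A) mc_sigma_additive.

(** Caratheodory extension of [mc] from the algebra of clopen sets to the sigma-algebra that it
    generates. *)
Lemma clopen_content_extension :
  exists mu : probability (g_sigma_algebraType (@clopen T)) R,
    forall A, clopen A -> mu A = (m A)%:E.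
Proof.
pose e := measure_extension mc.
have eE (A : set T) : clopen A -> e A = (m A)%:E.
  by move=> cA; rewrite /e /measure_extension measurable_mu_extE.
have eT : e setT = 1%E by rewrite eE ?mT//; exact: clopenT.
pose P : probability _ _ := HB.pack e (Measure_isProbability.Build _ _ _ e eT).
by exists P.
Qed.

End clopen_content.

(** * Finite prefixes and compactness of the Cantor space *)

Section cantor_prefix.
Implicit Types (x y : cantor_space) (s : seq bool) (n : nat).

Definition cyl s : set cantor_space := [set x | mkseq x (size s) = s].

Lemma eq_prefix_leq x y m n : (m <= n)%N ->
  mkseq x n = mkseq y n -> mkseq x m = mkseq y m.
Proof.
move=> mn /(congr1 (take m)); rewrite /mkseq -!map_take take_iota.
by move/minn_idPl : mn => ->.
Qed.

Lemma prefix_near x n :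
  \forall y \near x, mkseq (y : cantor_space) n = mkseq x n.
Proof.
elim: n => [|n ih]; first exact: filterE.
have xn : \forall y \near x, y n = x n.
  exact: (@proj_continuous nat (fun=> bool) n x _ (discrete_set1 (x n))).
by apply: filterS2 ih xn => y; rewrite !mkseqS => -> ->.
Qed.

Lemma open_prefix n (P : set (seq bool)) :
  open [set x : cantor_space | P (mkseq x n)].
Proof.
rewrite openE => x Px; rewrite /interior.
by apply: filterS (prefix_near x n) => y /= ->.
Qed.

Lemma clopen_prefix n (P : set (seq bool)) :
  clopen [set x : cantor_space | P (mkseq x n)].
Proof.
split; first exact: open_prefix.
by rewrite -openC; exact: (@open_prefix n (~` P)).
Qed.

Lemma clopen_cyl s : clopen (cyl s).
Proof. exact: (@clopen_prefix (size s) [set s]). Qed.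

(** Compactness for the cover by prefix classes. The length may depend on the point, for uniform
    continuity; a constant length gives representatives of the finitely many classes. *)
Lemma prefix_cover (n_ : cantor_space -> nat) :
  exists D : seq cantor_space,
    forall y, exists2 x, x \in D & mkseq y (n_ x) = mkseq x (n_ x).
Proof.
have := cantor_space_compact; rewrite compact_cover.
move=> /(_ cantor_space setT
  (fun x => [set y | mkseq y (n_ x) = mkseq x (n_ x)])).
case=> [x _|x _|D _ DT].
- exact: (@open_prefix (n_ x) [set mkseq x (n_ x)]).
- by exists x.
- by exists (D) => y; have [x /= xD xy] := DT y I; exists x.
Qed.

(** The complement of an open neighbourhood of [x] is compact and covered by the open sets of
    sequences that differ from [x] before [n]. The largest [n] of a finite subcover works. *)
Lemma nbhs_prefix x (A : set cantor_space) : nbhs x A ->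
  exists n, [set y | mkseq y n = mkseq x n] `<=` A.
Proof.
rewrite nbhsE; case=> O [oO Ox] OA.
have := subclosed_compact (open_closedC oO) cantor_space_compact (@subsetT _ _).
rewrite compact_cover.
move=> /(_ nat setT (fun n => ~` [set y | mkseq y n = mkseq x n])).
case=> [n _|y Oy|D _ DO].
- exact: (@open_prefix n (~` [set mkseq x n])).
- apply: contrapT => yx; suff xy : x = y by apply: Oy; rewrite -xy.
  apply/funext => i; have yxi : mkseq y i.+1 = mkseq x i.+1.
    by apply: contrapT => yxi; apply: yx; exists i.+1.
  by have := congr1 (nth false ^~ i) yxi; rewrite !nth_mkseq.
- exists (\max_(i <- D) i) => y xy; apply: OA; apply: contrapT => Oy.
  have [i /= iD] := DO y Oy; apply.
  by apply: eq_prefix_leq xy; exact: leq_bigmax_seq.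
Qed.

(** Uniform continuity, with prefix length in place of distance: two points with a long common
    prefix are both compared, within [e / 2], to one representative of a finite cover. *)
Lemma continuous_prefix (R : realType) (F : cantor_space -> R) (e : R) :
  continuous F -> 0 < e ->
  exists n, forall x y, mkseq x n = mkseq y n -> `|F x - F y| <= e.
Proof.
move=> cF e0.
have /choice[n_ Fn] : forall x, exists n, forall y,
    mkseq y n = mkseq x n -> `|F x - F y| <= e / 2.
  move=> x; have e20 : 0 < e / 2 by rewrite divr_gt0.
  have /cvgrPdist_le /(_ _ e20) /nbhs_prefix[n xn] := cF x.
  by exists n => y; exact: xn.
have [D DT] := prefix_cover n_.
exists (\max_(x <- D) n_ x) => x y xy; have [z zD xz] := DT x.
have yz : mkseq y (n_ z) = mkseq z (n_ z).
  rewrite -xz; apply/esym; apply: eq_prefix_leq xy.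
  exact: leq_bigmax_seq.
rewrite (splitr e) (le_trans (ler_distD (F z) _ _))//.
by apply: lerD; [rewrite distrC|]; exact: Fn.
Qed.

End cantor_prefix.

(** * Integrals on the Cantor space through masses of cylinders *)

Section cantor_integral_approximation.
Context {R : realType}.
Implicit Types (P : probability (Borel cantor_space) R).
Implicit Types (F : cantor_space -> R).

Lemma borel_clopen_measurable (A : set cantor_space) :
  clopen A -> measurable (A : set (Borel cantor_space)).
Proof. by move=> -[oA _]; exact: borel_open_measurable. Qed.

(** An open set is the union of the cylinders inside it, and there are countably many bit strings.
    Strings whose cylinder is not inside [O] contribute the empty set. *)
Lemma open_clopen_measurable (O : set cantor_space) : open O ->
  measurable (O : set (g_sigma_algebraType (@clopen cantor_space))).
Proof.
move=> oO.
have -> : O = \bigcup_(s : seq bool) [set x | cyl s `<=` O /\ cyl s x].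
  apply/seteqP; split=> [x Ox|x [s _ [sO /sO//]]].
  have [n xn] := nbhs_prefix (open_nbhs_nbhs (conj oO Ox)).
  by exists (mkseq x n) => //; split; rewrite /cyl/= size_mkseq.
apply: countable_bigcupT_measurable => // s; apply: sub_sigma_algebra.
by apply: (@clopen_prefix (size s) [set t | cyl s `<=` O /\ t = s]).
Qed.

Lemma cantor_continuous_integrable P F : continuous F ->
  P.-integrable [set: Borel cantor_space] (EFin \o F).
Proof.
move=> cF; have [n Fn] := continuous_prefix cF (@ltr01 R).
have [D DT] := prefix_cover (fun=> n).
apply: (@finite_bounded_integrable _ _ _ P _ (1 + \sum_(x <- D) `|F x|)).
  exact: borel_continuous_measurable.
move=> x; have [y yD xy] := DT x.
rewrite -[F x](subrK (F y)) (le_trans (ler_normD _ _))// lerD ?Fn//.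
by rewrite (big_rem y)//= lerDl sumr_ge0.
Qed.

(** The sum is the integral of the step function [G], which evaluates [F] at the first [n] bits of a
    point continued by [false]. It is within [e] of [F] everywhere. *)
Lemma cantor_integral_approx P F n (e : R) : continuous F ->
  (forall x y, mkseq x n = mkseq y n -> `|F x - F y| <= e) ->
  `|\int[P]_x F x -
     \sum_(w : n.-tuple bool) F (nth false w) * fine (P (cyl w))| <= e.
Proof.
move=> cF Fe.
pose G x := \sum_(w : n.-tuple bool) F (nth false w) * \1_(cyl w) x.
have GE x : G x = F (nth false (mkseq x n)).
  have sx : size (mkseq x n) == n by rewrite size_mkseq.
  rewrite /G (bigD1 (Tuple sx))//= big1 => [|w wx].
    by rewrite indicE mem_set ?mulr1 ?addr0// /cyl/= size_mkseq.
  rewrite indicE memNset ?mulr0// /cyl/= size_tuple => xw.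
  by move/eqP : wx; apply; apply/val_inj; rewrite /= -xw.
have m1 (w : n.-tuple bool) :
    measurable_fun [set: Borel cantor_space] (\1_(cyl w) : _ -> R).
  by apply: measurable_indic; exact: borel_clopen_measurable (clopen_cyl w).
have i1 (w : n.-tuple bool) :
    P.-integrable [set: Borel cantor_space] (EFin \o \1_(cyl w)).
  apply: (@finite_bounded_integrable _ _ _ P _ 1) => // x.
  by rewrite indicE; case: (_ \in _); rewrite /= ?normr1 ?normr0.
have iG : P.-integrable [set: Borel cantor_space] (EFin \o G).
  rewrite (_ : _ \o _ = fun x => (\sum_(w : n.-tuple bool)
    (F (nth false w))%:E * (\1_(cyl w) x)%:E)%E); last first.
    by apply/funext => x; rewrite /= /G -sumEFin.
  apply: integrable_sum => // w _; exact: (integrableZl measurableT _ (i1 w)).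
have -> : \sum_(w : n.-tuple bool) F (nth false w) * fine (P (cyl w)) =
    \int[P]_x G x.
  rewrite /Rintegral/= [X in fine X](_ : _ = (\int[P]_x (\sum_(w : n.-tuple bool)
    (F (nth false w))%:E * (\1_(cyl w) x)%:E)))%E; last first.
    by apply: eq_integral => x _; rewrite /= /G -sumEFin.
  rewrite integral_sum//; last first.
    by move=> w; exact: (integrableZl measurableT _ (i1 w)).
  rewrite -EFin_sum_fine/=; last first.
    move=> w _; apply: integrable_fin_num => //.
    exact: (integrableZl measurableT _ (i1 w)).
  apply: eq_bigr => w _; rewrite (integralZl measurableT (i1 w)).
  rewrite fineM//; last exact: integrable_fin_num (i1 w).
  rewrite integral_indic ?setIT//.
  exact: borel_clopen_measurable (clopen_cyl w).
have iF := cantor_continuous_integrable P cF.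
have iFG : P.-integrable [set: Borel cantor_space]
    (EFin \o (fun x => F x - G x)).
  exact: (integrableB measurableT iF iG).
rewrite -RintegralB//.
rewrite (le_trans (le_normr_Rintegral _ _))//.
rewrite (@le_trans _ _ (\int[P]_x e))//.
  apply: le_Rintegral => //.
  - exact: integrable_norm.
  - exact: finite_measure_integrable_cst.
  - by move=> x _; rewrite GE Fe// -{1}(mkseq_nth false (mkseq x n)) size_mkseq.
by rewrite probability_Rintegral_cst.
Qed.

End cantor_integral_approximation.

Lemma increasing_choice (P : nat -> nat -> Prop) :
  (forall j N, exists2 k, (N < k)%N & P j k) ->
  exists2 k_ : nat -> nat, increasing_seq k_ & forall j, P j (k_ j).
Proof.
move=> h.
have /choice[f fP] : forall jN : nat * nat,
    exists k, (jN.2 < k)%N /\ P jN.1 k.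
  by move=> [j N]; have [k Nk Pk] := h j N; exists k.
pose k_ := fix k_ j := if j is i.+1 then f (j, k_ i) else f (0%N, 0%N).
exists k_; last by case=> [|j]; [have [] := fP (0%N, 0%N)|
  have [] := fP (j.+1, k_ j)].
apply: leq_mono; apply: homo_ltn; first exact: ltn_trans.
by move=> j; have [] := fP (j.+1, k_ j).
Qed.

Lemma increasing_seq_ge (k_ : nat -> nat) j :
  increasing_seq k_ -> (j <= k_ j)%N.
Proof.
move=> ik; elim: j => // j ih; apply: (leq_ltn_trans ih).
(* [increasing_seq] also reflects the order, so the sequence is strictly increasing. *)
have kj : (k_ j.+1 <= k_ j)%N = false by rewrite -leEnat ik ltnn.
by rewrite ltnNge kj.
Qed.

Lemma probability_image (R : realType) d d' (T : measurableType d)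
    (T' : measurableType d') (P : probability T R) (g : T -> T') :
  measurable_fun [set: T] g ->
  exists Q : probability T' R, (forall A, Q A = P (g @^-1` A)) /\
    forall (f : T' -> R) M, measurable_fun [set: T'] f ->
      (forall x, `|f x| <= M) -> \int[Q]_x f x = \int[P]_x f (g x).
Proof.
move=> mg; pose G : {mfun T >-> T'} :=
  HB.pack g (isMeasurableFun.Build _ _ _ _ _ mg).
exists (distribution P G); split=> // f M mf fM.
rewrite /Rintegral -[in RHS](preimage_setT g); congr fine.
apply: (integral_pushforward mg) => //; first exact/measurable_EFinP.
rewrite preimage_setT.
apply: (@finite_bounded_integrable _ _ _ P (f \o g) M) => //.
  exact: measurableT_comp.
by move=> x; exact: fM.
Qed.

(** * Extraction of weakly convergent subsequences *)

Section cantor_weak_compactness.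
Context {R : realType}.

(** The limit measure comes from an ultrafilter. A genuine subsequence is then extracted diagonally:
    its [j]-th term nearly has the limit masses on all cylinders of length [j]. *)
Lemma cantor_weakly_compact (Q_ : nat -> probability (Borel cantor_space) R) :
  exists (Q : probability (Borel cantor_space) R) (k_ : nat -> nat),
    increasing_seq k_ /\
    forall F : cantor_space -> R, continuous F ->
      \int[Q_ (k_ j)]_x F x @[j --> \oo] --> \int[Q]_x F x.
Proof.
have [U [UU ooU]] := ultraFilterLemma eventually_filter.
have Qfin k A : clopen A -> Q_ k A \is a fin_num.
  by move=> cA; rewrite fin_num_measure//; exact: borel_clopen_measurable.
(* Sets that are not clopen get the dummy value 0; the extension only looks at clopen sets. *)
have /choice[m mP] : forall A : set cantor_space, exists l : R, 0 <= l /\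
    (clopen A -> fine (Q_ k A) @[k --> U] --> l).
  move=> A; have [cA|nA] := pselect (clopen A); last by exists 0.
  have [|l l0 Ul] := @ultra_cvg01 R U (fun k => fine (Q_ k A)) UU.
    move=> k; rewrite fine_ge0//= -lee_fin fineK ?Qfin//.
    by apply: probability_le1; exact: borel_clopen_measurable.
  by exists l.
have mcvg A : clopen A -> fine (Q_ k A) @[k --> U] --> m A.
  by move=> cA; have [_] := mP A; exact.
have [||A B cA cB AB|] := @clopen_content_extension R _ cantor_space_compact m.
- by move=> A; have [] := mP A.
- apply: (cvg_unique (@Rhausdorff R) (mcvg _ clopenT)).
  apply: cvg_near_cst; apply: nearW => k /=.
  by rewrite probability_setT.
- apply: (cvg_unique (@Rhausdorff R) (mcvg _ (clopenU cA cB))).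
  have -> : (fun k => fine (Q_ k (A `|` B))) =
      (fun k => fine (Q_ k A) + fine (Q_ k B)).
    apply/funext => k; have mA := borel_clopen_measurable cA.
    have mB := borel_clopen_measurable cB.
    by rewrite measureU// fineD ?Qfin.
  by apply: cvgD; exact: mcvg.
move=> mu muE.
(* The identity carries the measure from the sigma-algebra of clopen sets to the Borel one, since
   open sets belong to the former. *)
have [|Q [QE _]] := @probability_image R _ _
  (g_sigma_algebraType (@clopen cantor_space)) (Borel cantor_space) mu id.
  by apply: borel_map_measurable => O; exact: open_clopen_measurable.
exists Q.
have Qcyl s : fine (Q_ k (cyl s)) @[k --> U] --> fine (Q (cyl s)).
  have cs := clopen_cyl s; rewrite QE preimage_id muE//; exact: mcvg.
pose dist n k := \sum_(w : n.-tuple bool)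
  `|fine (Q_ k (cyl w)) - fine (Q (cyl w))|.
have dist0 n : dist n k @[k --> U] --> 0.
  rewrite (_ : 0 = \sum_(w : n.-tuple bool)
    `|fine (Q (cyl w)) - fine (Q (cyl w))|); last first.
    by rewrite big1// => w _; rewrite subrr normr0.
  apply: (@cvg_big R _ +%R 0 xpredT (@add_continuous R)) => w _.
  apply: cvg_norm; apply: cvgB; first exact: Qcyl.
  exact: cvg_cst.
(* As [U] contains every tail and [dist j] tends to 0 along [U], indices with small [dist j] exist
   beyond any bound. *)
have [k_ ik kd] : exists2 k_, increasing_seq k_ &
    forall j, dist j (k_ j) <= j.+1%:R^-1.
  apply: (@increasing_choice (fun j k => dist j k <= j.+1%:R^-1)) => j N.
  have Nk : \forall k \near U, (N < k)%N by apply: ooU; exact: nbhs_infty_gt.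
  have j0 : 0 < j.+1%:R^-1 :> R by rewrite invr_gt0.
  have /cvgr0Pnorm_le/(_ _ j0) dj := dist0 j.
  have [k [Nk' dk]] := filter_ex (filterI Nk dj).
  by exists k => //; rewrite (le_trans _ dk)// ler_norm.
exists k_; split=> // F cF; apply/cvgrPdist_le => e e0.
have e40 : 0 < e / 4 by rewrite divr_gt0.
have [n Fn] := continuous_prefix cF e40.
have [n1 Fn1] := continuous_prefix cF (@ltr01 R).
have [D DT] := prefix_cover (fun=> n1).
pose M := 1 + \sum_(x <- D) `|F x|.
have FM x : `|F x| <= M.
  have [y yD xy] := DT x.
  rewrite -[F x](subrK (F y)) (le_trans (ler_normD _ _))// lerD ?Fn1//.
  by rewrite (big_rem y)//= lerDl sumr_ge0.
near=> j.
have nj : (n <= j)%N by near: j; exact: nbhs_infty_ge.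
have Fj x y : mkseq x j = mkseq y j -> `|F x - F y| <= e / 4.
  by move=> xy; apply: Fn; exact: eq_prefix_leq xy.
have aQ := cantor_integral_approx Q cF Fj.
have aQj := cantor_integral_approx (Q_ (k_ j)) cF Fj.
set IQ := \int[Q]_x F x; set J := \int[Q_ (k_ j)]_x F x.
set SI := (X in `|_ - X| <= _) in aQ; set SJ := (X in `|_ - X| <= _) in aQj.
have SIJ : `|SI - SJ| <= M * j.+1%:R^-1.
  rewrite /SI /SJ -sumrB (le_trans (ler_norm_sum _ _ _))//.
  rewrite (@le_trans _ _ (M * dist j (k_ j)))//; last first.
    by rewrite ler_wpM2l//; exact: le_trans (FM point).
  rewrite /dist mulr_sumr ler_sum// => w _.
  by rewrite -mulrBr normrM distrC ler_wpM2r.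
(* The error budget is [e / 4] for each of the two step approximations and [e / 2] for the change of
   cylinder masses. *)
have Mj : M * j.+1%:R^-1 <= e / 2.
  rewrite ler_pdivrMr// -ler_pdivrMl; last by rewrite divr_gt0.
  rewrite (@le_trans _ _ j%:R)// ?ler_nat//.
  by near: j; exact: nbhs_infty_ger.
rewrite (_ : IQ - J = (IQ - SI) + (SI - SJ) - (J - SJ)); last by ring.
rewrite (le_trans (ler_normB _ _))//.
rewrite (_ : e = e / 4 + e / 2 + e / 4); last by field.
by rewrite lerD// (le_trans (ler_normD _ _))// lerD// (le_trans SIJ).
Unshelve. all: by end_near. Qed.

End cantor_weak_compactness.

(** * Empirical distributions and their weak limits *)

Section empirical.
Context {R : realType} {X : ptopologicalType}.
Implicit Types (theta : nat -> X).

Lemma ge0_empirical_integral theta n (f : X -> R) :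
  measurable_fun [set: Borel X] f -> (forall x, 0 <= f x) ->
  (\int[@empirical R X theta n]_x (f x)%:E =
   (n%:R^-1 * \sum_(t < n) f (theta t))%:E)%E.
Proof.
move=> mf f0.
have mEf : measurable_fun [set: Borel X] (EFin \o f).
  exact: (iffRL (@measurable_EFinP _ (Borel X) _ _ _)).
rewrite ge0_integral_mscale//=; last by move=> x _; rewrite lee_fin.
rewrite ge0_integral_measure_sum//=; last by move=> x _; rewrite lee_fin.
rewrite EFinM -sumEFin; congr (_ * _)%E; apply: eq_bigr => t _.
by rewrite integral_dirac//= diracT mul1e.
Qed.

(** Positive and negative parts reduce this to the nonnegative case. For [n = 0] both sides are 0,
    as [0^-1 = 0]. *)
Lemma empirical_integral theta n (f : X -> R) :
  measurable_fun [set: Borel X] f ->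
  \int[empirical theta n]_x f x = n%:R^-1 * \sum_(t < n) f (theta t).
Proof.
move=> mf; rewrite /Rintegral integralE.
under eq_integral do rewrite funerpos.
under [X in (_ - X)%E]eq_integral do rewrite funerneg.
rewrite !ge0_empirical_integral//; last 2 first.
- exact: measurable_funrneg.
- exact: measurable_funrpos.
rewrite -EFinB/= -mulrBr -sumrB; congr (_ * _); apply: eq_bigr => t _.
by rewrite -[in RHS](funrposBneg f).
Qed.

Lemma empirical_probability theta n : (0 < n)%N ->
  exists P : probability (Borel X) R, forall A, P A = empirical theta n A.
Proof.
move=> n0; have eT : (@empirical R X theta n) setT = 1%E.
  transitivity ((n%:R^-1 : R)%:E *
      \sum_(t < n) (\d_(theta t : Borel X) [set: Borel X] : \bar R))%E.
    by [].
  under eq_bigr do rewrite diracT.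
  by rewrite sumEFin sumr_const card_ord -EFinM mulVf// pnatr_eq0 -lt0n.
pose P : probability (Borel X) R := HB.pack
  (mscale (n%:R^-1 : R)%:nng (msum (fun t => \d_(theta t : Borel X)) n))
  (Measure_isProbability.Build _ _ _ (@empirical R X theta n) eT).
by exists P.
Qed.

End empirical.

(** The points are lifted through a continuous surjection [g] from the Cantor space, a limit of the
    lifted empirical distributions is found there, and its image under [g] is the limit on [X]. *)
Lemma empirical_weakly_compact (R : realType) (X : pmetricType R)
    (theta : nat -> X) (q : nat -> nat) :
  compact [set: X] -> (forall k, (0 < q k)%N) ->
  exists (mu : probability (Borel X) R) (k_ : nat -> nat),
    increasing_seq k_ /\ weakly_cvg (fun j => empirical theta (q (k_ j))) mu.
Proof.
move=> cX q0; have [g cg] := cantor_surj cX (@metric_hausdorff R X).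
have /choice[c cE] : forall t, exists x, g x = theta t.
  by move=> t; have [x _ <-] := 'surj_g (I : [set: X] (theta t)); exists x.
have /choice[Q_ QE] : forall k, exists P : probability (Borel cantor_space) R,
    forall A, P A = empirical c (q k) A.
  by move=> k; exact: empirical_probability.
have [Q [k_ [ik Qcvg]]] := cantor_weakly_compact Q_.
have [|mu [_ muE]] :=
    @probability_image R _ _ (Borel cantor_space) (Borel X) Q g.
  apply: borel_map_measurable => O oO; apply: borel_open_measurable.
  by move/continuousP : cg; exact.
exists mu, k_; split=> // f cf /bounded_setT_ex[M fM].
rewrite (muE f M)//; last exact: borel_continuous_measurable.
have cfg : continuous (f \o g).
  by move=> x; apply: continuous_comp; [exact: cg|exact: cf].
rewrite (_ : (fun _ => _) = (fun j => \int[Q_ (k_ j)]_x (f \o g) x)).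
  exact: Qcvg.
apply/funext => j; rewrite empirical_integral; last first.
  exact: borel_continuous_measurable.
transitivity (\int[empirical c (q (k_ j))]_x (f \o g) x); last first.
  by congr fine; apply: eq_measure_integral => A _ _; exact/esym/QE.
rewrite empirical_integral; last exact: borel_continuous_measurable.
by congr (_ * _); apply: eq_bigr => t _ /=; rewrite cE.
Qed.

(** * The transition operator and invariance of weak limits *)

Section transition.
Context {R : realType} {X : pmetricType R}.
Context {dZ : measure_display} {Z : measurableType dZ}.
Variables (nu : probability Z R) (F : Z * Borel X -> Borel X).
Hypothesis mF : measurable_fun [set: Z * Borel X] F.
Hypothesis cF : weakly_continuous nu F.

(** The Markov operator of the kernel of [F]: the expectation of [f] after one step from [x]. *)
Definition transition (f : X -> R) (x : X) : R := \int[nu]_z f (F (z, x)).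

Lemma measurable_section (f : X -> R) x : measurable_fun [set: Borel X] f ->
  measurable_fun [set: Z] (fun z => f (F (z, x))).
Proof.
move=> mf; apply: (@measurableT_comp _ _ _ _ (Borel X) R f) => //.
by apply: measurableT_comp => //; exact: measurable_pair2.
Qed.

Lemma transition01 (f : X -> R) : measurable_fun [set: Borel X] f ->
  (forall x, 0 <= f x <= 1) -> forall x, 0 <= transition f x <= 1.
Proof.
move=> mf f01 x; rewrite /transition Rintegral_ge0/=; last first.
  by move=> z _; have /andP[] := f01 (F (z, x)).
rewrite -[leRHS](probability_Rintegral_cst nu 1) le_Rintegral//.
- apply: (@finite_bounded_integrable _ _ _ nu _ 1).
    exact: measurable_section.
  by move=> z; have /andP[? ?] := f01 (F (z, x)); rewrite ger0_norm.
- exact: finite_measure_integrable_cst.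
- by move=> z _; have /andP[] := f01 (F (z, x)).
Qed.

Lemma transition_EFin (f : X -> R) x : measurable_fun [set: Borel X] f ->
  (forall x, 0 <= f x <= 1) ->
  (transition f x)%:E = (\int[nu]_z (f (F (z, x)))%:E)%E.
Proof.
move=> mf f01; rewrite /transition /Rintegral fineK//.
apply: integrable_fin_num => //.
apply: (@finite_bounded_integrable _ _ _ nu _ 1).
  exact: measurable_section.
by move=> z; have /andP[? ?] := f01 (F (z, x)); rewrite ger0_norm.
Qed.

Lemma transition_continuous (f : X -> R) : continuous f ->
  (forall x, 0 <= f x <= 1) -> continuous (transition f).
Proof. by move=> cf f01; apply: cF => //; exact: bounded_01. Qed.

(** [mu'] is the law after one step from [mu], the image of [nu \x mu] under [F]; invariance of [mu]
    says that [mu'] equals [mu]. *)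
Lemma smap_image (mu : probability (Borel X) R) :
  exists mu' : probability (Borel X) R,
    (forall A, measurable A ->
       mu' A = (\int[mu]_x nu [set z | A (F (z, x))])%E) /\
    forall f : X -> R, measurable_fun [set: Borel X] f ->
      (forall x, 0 <= f x <= 1) -> \int[mu']_x f x = \int[mu]_x transition f x.
Proof.
have [Q [QE Qf]] := probability_image (nu \x mu)%E mF.
exists Q; split=> [A mA|f mf f01].
  (* The product measure built by integrating over [mu] last has the required form; it agrees with
     [nu \x mu] by uniqueness. *)
  rewrite QE; transitivity ((nu \x^ mu)%E (F @^-1` A)).
    apply: product_measure_unique; last first.
      by rewrite -[X in measurable X]setTI; exact: mF.
    by move=> B C mB mC; exact: product_measure2E.
  apply: eq_integral => x _ /=; congr (nu _).
  by apply/seteqP; split=> z /=; rewrite /ysection/= in_setE.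
rewrite (Qf f 1)//; last first.
  by move=> x; have /andP[? ?] := f01 x; rewrite ger0_norm.
rewrite /Rintegral fubini_tonelli2/=.
- by congr fine; apply: eq_integral => x _; rewrite transition_EFin.
- apply/measurable_EFinP.
  exact: (@measurableT_comp _ _ _ _ (Borel X) R f).
- by move=> x; rewrite lee_fin; have /andP[] := f01 (F x).
Qed.

(** A pathwise statement that serves both kinds of update. The gap between the empirical integrals
    of [h n] and of its transition is the average increment minus a telescoped boundary term; both
    vanish in the limit. *)
Lemma limit_invariant (h : nat -> X -> R) (theta : nat -> X) (q : nat -> nat) :
  compact [set: X] ->
  (forall n, continuous (h n)) -> (forall n x, 0 <= h n x <= 1) ->
  (forall mu1 mu2 : probability (Borel X) R,
    (forall n, \int[mu1]_x h n x = \int[mu2]_x h n x) ->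
    forall A, measurable A -> mu1 A = mu2 A) ->
  (forall k, (0 < q k)%N) -> increasing_seq q ->
  (forall n, (q k)%:R^-1 *
     \sum_(t < q k) (h n (theta t.+1) - transition (h n) (theta t))
     @[k --> \oo] --> 0) ->
  exists (mu : probability (Borel X) R) (n_ : nat -> nat),
    [/\ invariant_smap nu F mu,
        forall k, (0 < n_ k)%N,
        increasing_seq n_ &
        weakly_cvg (fun k => empirical theta (n_ k)) mu].
Proof.
move=> cX ch h01 hsep q0 iq hq.
have [mu [k_ [ik wmu]]] := empirical_weakly_compact theta cX q0.
exists mu, (q \o k_); split; last exact: wmu; last 2 first.
- by move=> k; exact: q0.
- by move=> i j; rewrite /= iq -(ik i j) leEnat.
have [mu' [mu'E mu'f]] := smap_image mu.
(* It is enough that [mu] and its one-step image give each [h n] the same integral. *)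
move=> A mA; rewrite -mu'E//; apply: hsep A mA => n.
have mh := borel_continuous_measurable (ch n).
rewrite mu'f//.
have ct := transition_continuous (ch n) (h01 n).
have c1 := wmu _ (ch n) (bounded_01 (h01 n)).
have c2 := wmu _ ct (bounded_01 (transition01 mh (h01 n))).
apply/eqP; rewrite -subr_eq0; apply/eqP.
have ck : k_ j @[j --> \oo] --> \oo.
  apply/cvgnyPge => N; near=> j.
  rewrite (leq_trans _ (increasing_seq_ge j ik))//.
  by near: j; exact: nbhs_infty_ge.
have c3 := cvg_comp _ _ ck (hq n).
rewrite /= in c3.
(* The boundary term is at most [1 / q (k_ j)], because [h n] takes values in [[0, 1]]. *)
have c4 : ((q (k_ j))%:R^-1 * (h n (theta (q (k_ j))) - h n (theta 0)))
    @[j --> \oo] --> (0 : R).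
  apply/cvgr0Pnorm_le => e e0; near=> j.
  have qj : (j <= q (k_ j))%N.
    by rewrite (leq_trans (increasing_seq_ge j ik))// increasing_seq_ge.
  have qj0 : 0 < (q (k_ j))%:R :> R by rewrite ltr0n.
  rewrite normrM gtr0_norm ?invr_gt0// ler_pdivrMl// (@le_trans _ _ 1)//.
    have /andP[? ?] := h01 n (theta (q (k_ j))).
    have /andP[? ?] := h01 n (theta 0).
    by rewrite ler_norml; apply/andP; split; lra.
  rewrite -ler_pdivrMr// div1r (@le_trans _ _ j%:R)// ?ler_nat//.
  by near: j; exact: nbhs_infty_ger.
apply: (cvg_unique (@Rhausdorff R) (cvgB c1 c2)).
rewrite (_ : _ - _ = (fun j => (q (k_ j))%:R^-1 * \sum_(t < q (k_ j))
      (h n (theta t.+1) - transition (h n) (theta t))) -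
    (fun j => (q (k_ j))%:R^-1 * (h n (theta (q (k_ j))) - h n (theta 0)))).
  by have := cvgB c3 c4; rewrite subr0; exact.
apply/funext => j; rewrite !fctE.
rewrite !empirical_integral//; last exact: borel_continuous_measurable.
rewrite -!mulrBr; congr (_ * _); rewrite sumrB addrAC; congr (_ - _).
have := @telescope_sumr R 0 (q (k_ j)) (fun t => h n (theta t)) (leq0n _).
by rewrite big_mkord sumrB => <-; rewrite subKr.
Unshelve. all: by end_near. Qed.

End transition.

(** * A strong law for the increments *)

Lemma measure_image (R : realType) d d' (T : measurableType d)
    (T' : measurableType d') (mu : {measure set T -> \bar R}) (g : T -> T') :
  measurable_fun [set: T] g ->
  exists m : {measure set T' -> \bar R}, forall A, m A = mu (g @^-1` A).
Proof.
by move=> mg; unshelve eexists; first exact: (pushforward mu g).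
Qed.

(** Both sides are finite measures in [A], with equal total mass and equal values on rectangles, a
    pi-system generating the product sigma-algebra. *)
Lemma independent_prod (R : realType) d d1 d2 (T : measurableType d)
    (T1 : measurableType d1) (T2 : measurableType d2) (P : probability T R)
    (g1 : T -> T1) (g2 : T -> T2) (C : set T) :
  measurable_fun [set: T] g1 -> measurable_fun [set: T] g2 -> measurable C ->
  (forall A1 A2, measurable A1 -> measurable A2 ->
    P (g1 @^-1` A1 `&` g2 @^-1` A2 `&` C) =
    (P (g1 @^-1` A1 `&` g2 @^-1` A2) * P C)%E) ->
  forall A : set (T1 * T2), measurable A ->
    P ((fun w => (g1 w, g2 w)) @^-1` A `&` C) =
    (P ((fun w => (g1 w, g2 w)) @^-1` A) * P C)%E.
Proof.
move=> mg1 mg2 mC ind A mA.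
have mg : measurable_fun [set: T] (fun w => (g1 w, g2 w)).
  exact: measurable_fun_pair.
have [m1 m1E] := measure_image (mrestr P mC) mg.
have [m2 m2E] := measure_image P mg.
have pC0 : 0 <= fine (P C) by exact: fine_ge0.
have PC : (fine (P C))%:E = P C by rewrite fineK// fin_num_measure.
pose m3 := mscale (NngNum pC0) m2.
have m3E B : m3 B = (P ((fun w => (g1 w, g2 w)) @^-1` B) * P C)%E.
  by rewrite /m3/= /mscale/= m2E PC muleC.
rewrite -m3E; transitivity (m1 A); first by rewrite m1E.
apply: (@g_sigma_algebra_measure_unique _ R (T1 * T2)%type
  [set B `*` B' | B in measurable & B' in measurable] _ (fun=> setT)
  _ _ m1 m3) => //.
- by move=> _ [B mB [B' mB' <-]]; exact: measurableX.
- by move=> _; exists setT => //; exists setT => //; rewrite setXTT.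
- by rewrite bigcup_const//; exists 0%N.
- move=> _ _ [B mB [B' mB' <-]] [D mD [D' mD' <-]].
  exists (B `&` D); first exact: measurableI.
  by exists (B' `&` D'); [exact: measurableI|rewrite setXI].
- move=> _ [B mB [B' mB' <-]]; rewrite m1E.
  by apply/(etrans _ (esym (m3E _))); exact: ind.
- move=> _; rewrite m1E; apply: (@le_lt_trans _ _ 1%E); last exact: ltry.
  by apply: probability_le1; rewrite preimage_setT; exact: measurableI.
- by rewrite -measurable_prod_measurableType.
Qed.

(** * Averages of bounded orthogonal variables *)

Section orthogonal_averages.
Context {R : realType} {d} {T : measurableType d}.
Variables (P : probability T R) (D : nat -> T -> R).
Hypothesis mD : forall t, measurable_fun [set: T] (D t).
Hypothesis D_le1 : forall t w, `|D t w| <= 1.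
Hypothesis D_orthogonal : forall s t, (s < t)%N ->
  \int[P]_w (D s w * D t w) = 0.

Let S n w := \sum_(t < n) D t w.

Let mS n : measurable_fun [set: T] (S n).
Proof. by apply: measurable_sum => t; exact: mD. Qed.

Let S_le n w : `|S n w| <= n%:R.
Proof.
rewrite (le_trans (ler_norm_sum _ _ _))// (@le_trans _ _ (\sum_(t < n) 1))//.
  by rewrite ler_sum.
by rewrite sumr_const card_ord.
Qed.

Let iSD m n : P.-integrable [set: T] (EFin \o (fun w => S m w * D n w)).
Proof.
apply: (@finite_bounded_integrable _ _ _ P _ m%:R).
  exact: measurable_funM.
by move=> w; rewrite normrM -[leRHS]mulr1 ler_pM.
Qed.

Let iDD m n : P.-integrable [set: T] (EFin \o (fun w => D m w * D n w)).
Proof.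
apply: (@finite_bounded_integrable _ _ _ P _ 1).
  exact: measurable_funM.
by move=> w; rewrite normrM -[leRHS]mulr1 ler_pM.
Qed.

Let iSS n : P.-integrable [set: T] (EFin \o (fun w => S n w ^+ 2)).
Proof.
apply: (@finite_bounded_integrable _ _ _ P _ (n%:R * n%:R)).
  exact: measurable_funX.
by move=> w; rewrite normrX expr2 ler_pM.
Qed.

Let cross n m : (m <= n)%N -> \int[P]_w (S m w * D n w) = 0.
Proof.
elim: m => [_|m ih mn].
  under eq_Rintegral do rewrite /S big_ord0 mul0r.
  by rewrite probability_Rintegral_cst.
have -> : \int[P]_w (S m.+1 w * D n w) =
    \int[P]_w (S m w * D n w + D m w * D n w).
  by apply: eq_Rintegral => w _; rewrite /S big_ord_recr/= mulrDl.
by rewrite RintegralD// ih ?(ltnW mn)// D_orthogonal// addr0.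
Qed.

(** Pythagoras: the cross terms vanish and each of the [n] squares has mean at most 1. *)
Lemma orthogonal_second_moment n : \int[P]_w (S n w) ^+ 2 <= n%:R.
Proof.
elim: n => [|n ih].
  under eq_Rintegral do rewrite /S big_ord0 expr0n.
  by rewrite probability_Rintegral_cst.
have -> : \int[P]_w (S n.+1 w) ^+ 2 =
    \int[P]_w (S n w ^+ 2 + (2 * (S n w * D n w) + D n w * D n w)).
  by apply: eq_Rintegral => w _; rewrite /S big_ord_recr/=; ring.
have i2 : P.-integrable [set: T] (EFin \o (fun w => 2 * (S n w * D n w))).
  exact: (integrableZl measurableT 2 (iSD n n)).
have i3 : P.-integrable [set: T]
    (EFin \o (fun w => 2 * (S n w * D n w) + D n w * D n w)).
  exact: (integrableD measurableT i2 (iDD n n)).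
rewrite RintegralD// RintegralD// RintegralZl// cross// mulr0 add0r.
rewrite -natr1 lerD// -[leRHS](probability_Rintegral_cst P 1) le_Rintegral//.
  exact: finite_measure_integrable_cst.
move=> w _; rewrite (le_trans (ler_norm _))// normrM.
by rewrite -[leRHS]mulr1 ler_pM.
Qed.

(* Along the subsequence [2 ^ k] the second moments are summable, so that no
   maximal inequality is needed. *)
Lemma orthogonal_lln : {ae P, forall w,
  (2 ^ k.+1)%:R^-1 * \sum_(t < 2 ^ k.+1) D t w @[k --> \oo] --> 0}.
Proof.
pose Y k w := ((2 ^ k.+1)%:R^-1 * S (2 ^ k.+1) w) ^+ 2.
have mY k : measurable_fun [set: T] (EFin \o Y k).
  by apply/measurable_EFinP; apply: measurable_funX; exact: measurable_funM.
have Y0 k w : (0 <= (Y k w)%:E)%E by rewrite lee_fin sqr_ge0.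
have Yint k : (\int[P]_w (Y k w)%:E <= (1 / (2 ^ k.+1)%:R)%:E)%E.
  have q0 : 0 < (2 ^ k.+1)%:R :> R by rewrite ltr0n expn_gt0.
  under eq_integral do rewrite /Y exprMn EFinM.
  rewrite (integralZl measurableT (iSS _)).
  rewrite -[X in (_ * X)%E]fineK; last exact: integrable_fin_num (iSS _).
  rewrite -EFinM lee_fin exprVn ler_pdivrMl ?exprn_gt0//.
  rewrite (le_trans (orthogonal_second_moment _))//.
  by rewrite expr2 div1r mulfK ?gt_eqF.
have mSum : measurable_fun [set: T] (fun w => \sum_(k <oo) (Y k w)%:E)%E.
  apply: (@ge0_emeasurable_sum _ _ _ setT (fun k w => (Y k w)%:E) xpredT).
  - by move=> k w _ _; exact: Y0.
  - by move=> k _; exact: mY.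
(* The means of the [Y k] are at most [1 / 2 ^ (k + 1)], so their sum has mean at most 1 and is
   finite almost everywhere. *)
have iSum : P.-integrable [set: T] (fun w => \sum_(k <oo) (Y k w)%:E)%E.
  apply/integrableP; split=> //.
  rewrite (eq_integral (fun w => \sum_(k <oo) (Y k w)%:E)%E); last first.
    by move=> w _; rewrite gee0_abs// nneseries_ge0.
  rewrite integral_nneseries//.
  apply: (@le_lt_trans _ _ 1%:E); last exact: ltry.
  apply: le_trans (@epsilon_trick0 R 1 xpredT ler01).
  apply: lee_nneseries => [k _ _|k _]; last exact: Yint.
  by apply: integral_ge0 => w _; exact: Y0.
have := integrable_ae measurableT iSum.
apply: filterS => w /(_ I) Yw.
have {}Yw : (\sum_(k <oo) (Y k w)%:E < +oo)%E by rewrite ltey_eq Yw.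
have /fine_cvgP[_ tail0] := nneseries_tail_cvg Yw (fun k _ => Y0 k w).
(* A term of a convergent nonnegative series is squeezed between 0 and the tail that starts with
   it. *)
have Yw0 : Y k w @[k --> \oo] --> 0.
  apply: (squeeze_cvgr _ (@cvg_cst _ (0 : R) _ _ _) tail0).
  apply: nearW => k; apply/andP; split; first exact: sqr_ge0.
  have tail_ge0 N : (0 <= \sum_(N <= j <oo) (Y j w)%:E)%E.
    by apply: nneseries_ge0 => j _ _; exact: Y0.
  rewrite -lee_fin fineK.
    rewrite (@nneseries_split R _ k 1%N) => [|j _]; last exact: Y0.
    by rewrite addn1 big_nat1 leeDl.
  rewrite ge0_fin_numE// (le_lt_trans _ Yw)//.
  rewrite [leRHS](@nneseries_split R _ 0 k) => [|j _]; last exact: Y0.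
  by rewrite add0n leeDr// sume_ge0 => // j _; exact: Y0.
apply/cvgr0Pnorm_le => e e0.
have e20 : 0 < e ^+ 2 by rewrite exprn_gt0.
move/cvgr0Pnorm_le : Yw0 => /(_ _ e20); apply: filterS => k.
rewrite /Y normrX ler_pXn2r// ?nnegrE// ltW//.
Qed.

End orthogonal_averages.

(** * Increments of the stochastic iterates *)

Section stochastic_iterates.
Context {R : realType} {X : pmetricType R}.
Context {dZ : measure_display} {Z : measurableType dZ}.
Context {dO : measure_display} {Omega : measurableType dO}.
Variables (nu : probability Z R) (F : Z * Borel X -> Borel X).
Hypothesis mF : measurable_fun [set: Z * Borel X] F.
Hypothesis cF : weakly_continuous nu F.
Variables (P : probability Omega R) (xi : nat -> {mfun Omega >-> Z}).
Variable theta : nat -> {mfun Omega >-> Borel X}.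
Hypothesis iter : stochastic_iterates P nu F xi theta.

(** Independence from the history gives the case of rectangles, which extends to all events of the
    pair of iterates. *)
Lemma noise_independent i t (A : set (Borel X * Borel X)) (B : set Z) :
  (i <= t)%N -> measurable A -> measurable B ->
  P ((fun w => (theta i w, theta t w)) @^-1` A `&` xi t @^-1` B) =
  (P ((fun w => (theta i w, theta t w)) @^-1` A) * nu B)%E.
Proof.
move=> it mA mB; have [_ ind] := iter.
have xiB : P (xi t @^-1` B) = nu B.
  have := ind t (fun=> setT) B (fun=> measurableT) mB.
  rewrite /= (_ : [set w | _] = setT); last by apply/seteqP; split.
  by rewrite setTI probability_setT mul1e.
rewrite -xiB; apply: independent_prod => //.
  by rewrite -[X in measurable X]setTI; exact: measurable_funP.
move=> A1 A2 mA1 mA2; rewrite xiB.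
(* Only times [i] and [t] are constrained; the intersection also covers [i = t]. *)
pose A' k := (if k == i then A1 else setT) `&` (if k == t then A2 else setT).
have mA' k : measurable (A' k) by apply: measurableI; case: ifP.
have := ind t A' B mA' mB.
rewrite /= (_ : [set w | _] = theta i @^-1` A1 `&` theta t @^-1` A2)//.
apply/seteqP; split=> [w Aw|w [A1w A2w] k kt].
  split; first by have [] := Aw i it; rewrite eqxx.
  by have [_] := Aw t (leqnn _); rewrite eqxx.
by split; case: eqP => // ->.
Qed.

(** The Markov property tested against a function of an earlier iterate. The law of
    [((theta i, theta t), xi t)] is a product, so the noise can be integrated out first. *)
Lemma transition_expectation i t (g f : X -> R) : (i <= t)%N ->
  measurable_fun [set: Borel X] g -> (forall x, 0 <= g x <= 1) ->
  continuous f -> (forall x, 0 <= f x <= 1) ->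
  \int[P]_w (g (theta i w) * f (theta t.+1 w)) =
  \int[P]_w (g (theta i w) * transition nu F f (theta t w)).
Proof.
move=> it mg g01 cf f01; have [next _] := iter.
have mf := borel_continuous_measurable cf.
have mPf := borel_continuous_measurable (transition_continuous cF cf f01).
have Pf01 := transition01 nu mF mf f01.
have mul01 (a b : R) : 0 <= a <= 1 -> 0 <= b <= 1 -> 0 <= a * b <= 1.
  move=> /andP[a0 a1] /andP[b0 b1]; rewrite mulr_ge0//=.
  by rewrite -[leRHS]mulr1 ler_pM.
have norm01 (a : R) : 0 <= a <= 1 -> `|a| <= 1.
  by move=> /andP[? ?]; rewrite ger0_norm.
pose J w := (theta i w, theta t w).
have mJ : measurable_fun [set: Omega] J by exact: measurable_fun_pair.
have mJxi : measurable_fun [set: Omega] (fun w => (J w, xi t w)).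
  exact: measurable_fun_pair.
have [L [LE Lf]] := probability_image P mJ.
have [Q [QE Qf]] := probability_image P mJxi.
pose phi (y : (Borel X * Borel X) * Z) : R := g y.1.1 * f (F (y.2, y.1.2)).
have mphi : measurable_fun setT phi.
  apply: measurable_funM.
    by apply: (@measurableT_comp _ _ _ _ (Borel X) R g) => //;
      exact: measurableT_comp.
  apply: (@measurableT_comp _ _ _ _ (Borel X) R f) => //.
  apply: measurableT_comp => //; apply: measurable_fun_pair => //.
  exact: measurableT_comp.
have phi01 y : 0 <= phi y <= 1 by exact: mul01.
pose psi (y : Borel X * Borel X) : R := g y.1 * transition nu F f y.2.
have mpsi : measurable_fun setT psi.
  apply: measurable_funM.
    exact: (@measurableT_comp _ _ _ _ (Borel X) R g).
  exact: (@measurableT_comp _ _ _ _ (Borel X) R (transition nu F f)).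
have psi01 y : 0 <= psi y <= 1 by exact: mul01.
transitivity (\int[Q]_y phi y).
  rewrite (Qf phi 1)//; last by move=> y; exact: norm01.
  by apply: eq_Rintegral => w _; rewrite /phi/= next.
transitivity (\int[L]_y psi y); last first.
  by rewrite (Lf psi 1)// => y; exact: norm01.
rewrite /Rintegral; congr fine.
(* [Q] and [L \x nu] agree on rectangles by independence of the noise, hence are equal. *)
transitivity (\int[(L \x nu)%E]_y (phi y)%:E)%E.
  apply: eq_measure_integral => E mE _; apply/esym.
  apply: product_measure_unique => // A B mA mB.
  transitivity (P (J @^-1` A) * nu B)%E; last by congr (_ * _)%E; exact/esym/LE.
  exact: etrans (QE _) (noise_independent it mA mB).
rewrite fubini_tonelli1//=; last 2 first.
- exact/measurable_EFinP.
- by move=> y; rewrite lee_fin; have /andP[] := phi01 y.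
apply: eq_integral => y _; rewrite /fubini_F /phi/= /psi EFinM transition_EFin//.
under eq_integral do rewrite EFinM.
rewrite ge0_integralZl_EFin//.
- by move=> z _; rewrite lee_fin; have /andP[] := f01 (F (z, y.2)).
- by apply/measurable_EFinP; exact: (measurable_section mF _ mf).
- by have /andP[] := g01 y.1.
Qed.

Definition increment (f : X -> R) (t : nat) (w : Omega) : R :=
  f (theta t.+1 w) - transition nu F f (theta t w).

(* The increments are orthogonal: given the trajectory up to time [t], the noise
   is independent of it, so that the mean of [f (theta t.+1)] is
   [transition nu F f (theta t)]. *)
Lemma increment_lln (f : X -> R) :
  continuous f -> (forall x, 0 <= f x <= 1) ->
  {ae P, forall w, (2 ^ k.+1)%:R^-1 * \sum_(t < 2 ^ k.+1)
    (f (theta t.+1 w) - transition nu F f (theta t w)) @[k --> \oo] --> 0}.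
Proof.
move=> cf f01.
have mf := borel_continuous_measurable cf.
have mPf := borel_continuous_measurable (transition_continuous cF cf f01).
have Pf01 := transition01 nu mF mf f01.
have mtheta (g : X -> R) t : measurable_fun [set: Borel X] g ->
    measurable_fun [set: Omega] (fun w => g (theta t w)).
  by move=> mg; exact: (@measurableT_comp _ _ _ _ (Borel X) R g).
have iprod (g1 g2 : X -> R) s t :
    measurable_fun [set: Borel X] g1 -> (forall x, 0 <= g1 x <= 1) ->
    measurable_fun [set: Borel X] g2 -> (forall x, 0 <= g2 x <= 1) ->
    P.-integrable [set: Omega]
      (EFin \o (fun w => g1 (theta s w) * g2 (theta t w))).
  move=> mg1 g101 mg2 g201.
  apply: (@finite_bounded_integrable _ _ _ P _ 1).
    by apply: measurable_funM; exact: mtheta.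
  move=> w; have /andP[? ?] := g101 (theta s w).
  have /andP[? ?] := g201 (theta t w).
  by rewrite ger0_norm ?mulr_ge0// -[leRHS]mulr1 ler_pM.
apply: (@orthogonal_lln R _ _ P (increment f)).
- by move=> t; apply: measurable_funB; exact: mtheta.
- move=> t w; rewrite /increment.
  have /andP[? ?] := f01 (theta t.+1 w).
  have /andP[? ?] := Pf01 (theta t w).
  by rewrite ler_norml; apply/andP; split; lra.
move=> s t st.
(* The increment at [t] is orthogonal to functions of earlier iterates. The increment at [s] is a
   difference of two such functions, at times [s + 1 <= t] and [s]. *)
have orth (g : X -> R) i : (i <= t)%N -> measurable_fun [set: Borel X] g ->
    (forall x, 0 <= g x <= 1) ->
    \int[P]_w (g (theta i w) * f (theta t.+1 w) -
               g (theta i w) * transition nu F f (theta t w)) = 0.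
  move=> it mg g01; rewrite RintegralB//; [|exact: iprod..].
  by rewrite transition_expectation// subrr.
have -> : \int[P]_w (increment f s w * increment f t w) =
    \int[P]_w ((f (theta s.+1 w) * f (theta t.+1 w) -
               f (theta s.+1 w) * transition nu F f (theta t w)) -
              (transition nu F f (theta s w) * f (theta t.+1 w) -
               transition nu F f (theta s w) * transition nu F f (theta t w))).
  by apply: eq_Rintegral => w _; rewrite /increment; ring.
have idiff (g : X -> R) i : measurable_fun [set: Borel X] g ->
    (forall x, 0 <= g x <= 1) -> P.-integrable [set: Omega]
    (EFin \o (fun w => g (theta i w) * f (theta t.+1 w) -
                       g (theta i w) * transition nu F f (theta t w))).
  move=> mg g01; have i1 := iprod g f i t.+1 mg g01 mf f01.
  have i2 := iprod g (transition nu F f) i t mg g01 mPf Pf01.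
  exact: (integrableB measurableT i1 i2).
rewrite RintegralB//; [|exact: idiff..].
by rewrite !orth ?subrr// ltnW.
Qed.

End stochastic_iterates.

(** * Invariant limits for deterministic and stochastic updates *)

Theorem theorem5p4 (R : realType) (X : pmetricType R)
    (compactX : compact [set: X]) :
  (* deterministic update map *)
  (forall F : X -> X, continuous F ->
   forall theta : nat -> X, (forall t, theta t.+1 = F (theta t)) ->
   exists (mu : probability (Borel X) R) (n_ : nat -> nat),
     [/\ invariant_map F mu,
         forall k, (0 < n_ k)%N,
         increasing_seq n_ &
         weakly_cvg (fun k => empirical theta (n_ k)) mu])
  /\
  (* stochastic update map *)
  (forall (dZ : measure_display) (Z : measurableType dZ) (nu : probability Z R)
     (F : Z * Borel X -> Borel X),
   measurable_fun [set: Z * Borel X] F -> weakly_continuous nu F ->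
   forall (dO : measure_display) (Omega : measurableType dO)
     (P : probability Omega R) (xi : nat -> {mfun Omega >-> Z})
     (theta : nat -> {mfun Omega >-> Borel X}),
   stochastic_iterates P nu F xi theta ->
   {ae P, forall w, exists (mu : probability (Borel X) R) (n_ : nat -> nat),
     [/\ invariant_smap nu F mu,
         forall k, (0 < n_ k)%N,
         increasing_seq n_ &
         weakly_cvg (fun k => empirical (fun t => theta t w) (n_ k)) mu]}).
Proof.
have [h [ch h01 hsep]] := separating_family compactX.
(* The times along which the strong law is available. *)
pose q k := (2 ^ k.+1)%N.
have q0 k : (0 < q k)%N by rewrite expn_gt0.
have iq : increasing_seq q.
  by move=> m n; rewrite leEnat leq_exp2l.
split=> [F cF theta thetaE|dZ Z nu F mF cF dO Omega P xi theta iter].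
(* A deterministic map is a stochastic one with one-point noise; its transition operator is
   composition with [F], and its increments vanish identically. *)
- pose nu : probability unit R := \d_tt.
  pose F' (zx : unit * Borel X) : Borel X := F zx.2.
  have tE (f : X -> R) x : transition nu F' f x = f (F x).
    by rewrite /transition /F'/= probability_Rintegral_cst.
  have mF : measurable_fun [set: Borel X] (F : Borel X -> Borel X).
    apply: borel_map_measurable => U oU; apply: borel_open_measurable.
    by move/continuousP : cF; exact.
  have mF' : measurable_fun [set: unit * Borel X] F' by exact: measurableT_comp.
  have cF' : weakly_continuous nu F'.
    move=> f cf _; rewrite (_ : (fun _ => _) = f \o F).
      by move=> x; apply: continuous_comp; [exact: cF|exact: cf].
    by apply/funext => x; exact: tE.
  have [|mu [n_ [imu n0 ni wmu]]] :=
      limit_invariant mF' cF' (theta := theta) compactX ch h01 hsep q0 iq.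
    move=> n; apply: cvg_near_cst; apply: nearW => k.
    by rewrite big1 ?mulr0// => t _; rewrite tE thetaE subrr.
  exists mu, n_; split=> // A mA; rewrite imu//.
  have mFA : measurable (F @^-1` A : set (Borel X)).
    by rewrite -[X in measurable X]setTI; exact: mF.
  rewrite -[in RHS](setIT (F @^-1` A)) -integral_indic//.
(* The family [h] is countable, so one null set serves all its members; off it, the pathwise
   statement applies. *)
- have : {ae P, forall w, forall n, (q k)%:R^-1 * \sum_(t < q k)
      (h n (theta t.+1 w) - transition nu F (h n) (theta t w))
      @[k --> \oo] --> 0}.
    by apply/ae_foralln => n; exact: (increment_lln mF cF iter (ch n) (h01 n)).
  apply: filterS => w hw.
  exact: (limit_invariant mF cF (theta := fun t => theta t w)
    compactX ch h01 hsep q0 iq hw).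
Qed.
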